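(* Let $\widehat\sigma\colon \mathrm{Sym}^+(3)\to \mathrm{Sym}(3)$ be an isotropic function with $$\widehat\sigma(B)=\beta_0\,\mathbb 1+\beta_1\,B+\beta_{-1}\,B^{-1}\qquad\text{for all } B\in \mathrm{Sym}^+(3),$$ where $\beta_{-1},\beta_0,\beta_1$ are scalar-valued functions depending on $B$. For $B\in\mathrm{Sym}^+(3)$ let $\lambda_1^2,\lambda_2^2,\lambda_3^2$ (with $\lambda_i>0$) denote the eigenvalues of $B$ and $\sigma_1,\sigma_2,\sigma_3$ the corresponding eigenvalues of $\widehat\sigma(B)$. Consider the following conditions on $\widehat\sigma$: - (E-TSS): $\beta_{-1}\le 0$, $\beta_0\le 0$ and $\beta_1>0$ for all $B\in\mathrm{Sym}^+(3)$. - (WE-TSS): for every $B\in\mathrm{Sym}^+(3)$ that is not a positive multiple of $\mathbb 1$, $\beta_{-1}\le 0$ and $\beta_1\ge 0$, with at least one of these two inequalities being strict (which one may depend on $B$). - (BE$^+$): for all $B\in\mathrm{Sym}^+(3)$ and all $i,j\in\{1,2,3\}$, $\lambda_i>\lambda_j$ implies $\sigma_i>\sigma_j$. - (bi-coax): for every $B\in\mathrm{Sym}^+(3)$, every eigenvector of $B$ is an eigenvector of $\widehat\sigma(B)$ and vice versa. - (semi): there exist real-valued functions $\psi_0,\psi_1,\psi_2$ depending on the matrix invariants of $B$ such that $B=\psi_0\,\mathbb 1+\psi_1\,\widehat\sigma(B)+\psi_2\,\widehat\sigma(B)^2$ for all $B\in\mathrm{Sym}^+(3)$. - (invert): there exists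 a function $\widehat\sigma^{-1}\colon\mathrm{Sym}(3)\to\mathrm{Sym}^+(3)$ with $B=\widehat\sigma^{-1}(\widehat\sigma(B))$ for all $B\in\mathrm{Sym}^+(3)$ and $Y=\widehat\sigma(\widehat\sigma^{-1}(Y))$ for all $Y\in\mathrm{Sym}(3)$. Then the following implications hold: $$\text{(E-TSS)}\Rightarrow\text{(WE-TSS)}\Rightarrow\text{(BE}^+)\Rightarrow\text{(bi-coax)}\Leftrightarrow\text{(semi)},\qquad \text{(invert)}\Rightarrow\text{(semi)}.$$ On the other hand, (invert) does not in general imply (BE$^+$), i.e. there exists such a function $\widehat\sigma$ which satisfies (invert) but not (BE$^+$).
   Context: $\mathrm{Sym}(3)$ is the set of real symmetric $3\times3$ matrices, $\mathrm{Sym}^+(3)$ the subset of positive definite ones, $\mathbb 1$ the identity matrix, $\mathrm O(3)$ the orthogonal group. A function $\widehat\sigma\colon \mathrm{Sym}^+(3)\to \mathrm{Sym}(3)$ is isotropic if $\widehat\sigma(Q^TBQ)=Q^T\widehat\sigma(B)Q$ for all $B\in\mathrm{Sym}^+(3)$ and $Q\in\mathrm O(3)$. For isotropic $\widehat\sigma$, every eigenvector of $B$ is an eigenvector of $\widehat\sigma(B)$; the eigenvalues $\sigma_i$ of $\widehat\sigma(B)$ corresponding to the eigenvalues $\lambda_i^2$ (listed with multiplicity) of $B$ are the uniquely determined reals such that each eigenvector of $B$ to the eigenvalue $\lambda_i^2$ is an eigenvector of $\widehat\sigma(B)$ to the eigenvalue $\sigma_i$. The matrix (principal) invariants of $B$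 are $I_1=\operatorname{tr}B$, $I_2=\tfrac12[(\operatorname{tr}B)^2-\operatorname{tr}(B^2)]$, $I_3=\det B$. *)

(* Defs.v *)
From mathcomp Require Import all_boot all_order all_algebra.
From mathcomp Require Import classical_sets functions reals.

Set Implicit Arguments.
Unset Strict Implicit.
Unset Printing Implicit Defensive.

Import Order.TTheory GRing.Theory Num.Theory.

Local Open Scope classical_set_scope.
Local Open Scope ring_scope.

Section Matrices.
Context {R : realType}.
Implicit Types (A B S Q : 'M[R]_3) (v : 'cV[R]_3).

Definition Sym3 : set 'M[R]_3 := [set A | A \is symmetricmx].

Definition SymPos3 : set 'M[R]_3 :=
  [set A | Sym3 A /\ forall v, v != 0 -> 0 < (v^T *m A *m v) 0 0].

Definition O3 : set 'M[R]_3 := [set Q | Q^T *m Q = 1%:M].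

(* Column vectors; the library's [eigenspace] consists of row vectors. *)
Definition eigenvector_for A (a : R) v := v != 0 /\ A *m v = a *: v.

Definition eigenvector A v := exists a : R, eigenvector_for A a v.

(* [mu] lists the eigenvalues of [A] with their algebraic multiplicity. *)
Definition eigenvalue_list A (mu : 'I_3 -> R) :=
  char_poly A = \prod_i ('X - (mu i)%:P).

(* For an eigenvalue [mu i] of [B] there is at most one such [s i], since
   the eigenspace of [B] for [mu i] is nonzero. *)
Definition corresponding_eigenvalues B S (mu s : 'I_3 -> R) :=
  forall i v, eigenvector_for B (mu i) v -> eigenvector_for S (s i) v.

Definition inv1 B : R := \tr B.
Definition inv2 B : R := 2^-1 * ((\tr B) ^+ 2 - \tr (B *m B)).
Definition inv3 B : R := \det B.

End Matrices.

(* A function on a set of matrices is a total function on ['M[R]_3] of which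
   only the values on that set matter. *)
Section Conditions.
Context {R : realType}.
Variables (sigma : 'M[R]_3 -> 'M[R]_3) (betam1 beta0 beta1 : 'M[R]_3 -> R).

Definition isotropic_function :=
  set_fun SymPos3 Sym3 sigma /\
  forall B Q, SymPos3 B -> O3 Q ->
    sigma (Q^T *m B *m Q) = Q^T *m sigma B *m Q.

Definition representation :=
  forall B, SymPos3 B ->
    sigma B = (beta0 B)%:M + beta1 B *: B + betam1 B *: invmx B.

Definition E_TSS :=
  forall B, SymPos3 B -> [/\ betam1 B <= 0, beta0 B <= 0 & 0 < beta1 B].

Definition WE_TSS :=
  forall B, SymPos3 B -> ~ (exists c : R, 0 < c /\ B = c%:M) ->
    [/\ betam1 B <= 0, 0 <= beta1 B & betam1 B < 0 \/ 0 < beta1 B].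

Definition BE_plus :=
  forall B, SymPos3 B -> forall lambda s : 'I_3 -> R,
    (forall i, 0 < lambda i) ->
    eigenvalue_list B (fun i => lambda i ^+ 2) ->
    corresponding_eigenvalues B (sigma B) (fun i => lambda i ^+ 2) s ->
    forall i j, lambda i > lambda j -> s i > s j.

Definition bi_coaxial :=
  forall B, SymPos3 B -> forall v, eigenvector B v <-> eigenvector (sigma B) v.

Definition semi_invertible :=
  exists psi0 psi1 psi2 : R -> R -> R -> R,
    forall B, SymPos3 B ->
      B = (psi0 (inv1 B) (inv2 B) (inv3 B))%:M
          + psi1 (inv1 B) (inv2 B) (inv3 B) *: sigma B
          + psi2 (inv1 B) (inv2 B) (inv3 B) *: (sigma B *m sigma B).

Definition invertible :=
  exists tau : 'M[R]_3 -> 'M[R]_3,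
    [/\ set_fun Sym3 SymPos3 tau,
        forall B, SymPos3 B -> B = tau (sigma B)
      & forall Y, Sym3 Y -> Y = sigma (tau Y)].

End Conditions.

(* Main.v *)
Require Import Defs.
From mathcomp Require Import all_boot all_order all_algebra.
From mathcomp Require Import fingroup perm spectral sesquilinear complex.
From mathcomp Require Import ring lra.
From mathcomp Require Import boolp classical_sets functions reals.

(** Write [B = Q^T D Q] with [Q] orthogonal and [D] diagonal. The
    representation gives [sigma B = Q^T f(D) Q] with
    [f x = beta0 + beta1 x + betam1 / x], the coefficients being taken at this
    one [B]. Every condition on [sigma] thus becomes a condition on the scalar
    function [f] (here [principal_response]) at the eigenvalues of [B].

    When [B] has two distinct eigenvalues, the signs in [WE_TSS] make [f]
    strictly increasing on the positive reals, which is [BE_plus]. If [f] is injective on the spectrum of [B], the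
    eigenspaces of [B] and of [sigma B] agree; conversely, if [f] identifies two
    eigenvalues, the sum of two eigenvectors belonging to them is an eigenvector
    of [sigma B] only.
    So bi-coaxiality is injectivity on spectra ([spectrally_injective]).

    Injectivity on a spectrum of at most three points allows Lagrange
    interpolation, hence [B = p(sigma B)] with [p] of degree at most two.
    Matrices with equal invariants have the same spectrum, so they are
    orthogonally conjugate ([same_invariants_conj]) and isotropy lets them share
    [p]; the coefficients can therefore be chosen as functions of the invariants.
    Conversely [B = p(sigma B)] transports eigenvectors of [sigma B] to [B].

    For an invertible [sigma], let [v] be an eigenvector of [sigma B]. The
    reflection in [v] commutes with [sigma B]; by isotropy and injectivity it
    commutes with [B], so [v] is an eigenvector of [B].

    The order-reversing example is [sigma B = B^-1 - B]: the function
    [x^-1 - x] is a strictly decreasing bijection from the positive reals onto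
    the reals, so [sigma] is a bijection by functional calculus. *)

Set Implicit Arguments.
Unset Strict Implicit.
Unset Printing Implicit Defensive.

Import Order.TTheory GRing.Theory Num.Theory.

Local Open Scope ring_scope.

(** * Orthogonal reflections *)

Section Reflections.
Context {F : realFieldType} {n : nat}.
Implicit Types (u v w : 'cV[F]_n) (B : 'M[F]_n).

Lemma dotC u v : (u^T *m v) 0 0 = (v^T *m u) 0 0.
Proof. by rewrite -[u in RHS]trmxK -trmx_mul [RHS]mxE. Qed.

Lemma dot_gt0 v : v != 0 -> 0 < (v^T *m v) 0 0.
Proof.
have dotE : (v^T *m v) 0 0 = \sum_i v i 0 ^+ 2.
  by rewrite mxE; apply: eq_bigr => i _; rewrite mxE expr2.
move=> v0; rewrite dotE lt_def sumr_ge0 ?andbT => [|i _]; last exact: sqr_ge0.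
apply: contra v0; rewrite psumr_eq0 => [/allP s0|i _]; last exact: sqr_ge0.
apply/eqP/colP => i; rewrite mxE; apply/eqP; rewrite -sqrf_eq0.
exact: (implyP (s0 i (mem_index_enum i))).
Qed.

Definition reflection v : 'M[F]_n :=
  1%:M - (2 / (v^T *m v) 0 0) *: (v *m v^T).

Lemma reflectionE v w :
  reflection v *m w = w - (2 * (v^T *m w) 0 0 / (v^T *m v) 0 0) *: v.
Proof.
rewrite mulmxBl mul1mx -scalemxAl -mulmxA {1}[v^T *m w]mx11_scalar.
by rewrite mul_mx_scalar scalerA mulrAC.
Qed.

Lemma reflection_sym v : (reflection v)^T = reflection v.
Proof. by rewrite linearB /= linearZ /= trmx_mul trmxK trmx1. Qed.

Lemma reflection_self v : v != 0 -> reflection v *m v = - v.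
Proof.
move=> /dot_gt0 /lt0r_neq0 v0; rewrite reflectionE mulfK //.
by rewrite scaler_nat mulr2n opprD addrA subrr sub0r.
Qed.

Lemma reflectionK v : v != 0 -> reflection v *m reflection v = 1%:M.
Proof.
move=> v0; rewrite {2}/reflection mulmxBr mulmx1 -scalemxAr mulmxA.
by rewrite reflection_self // mulNmx scalerN opprK subrK.
Qed.

Lemma reflection_swap u v : u != v -> (u^T *m u) 0 0 = (v^T *m v) 0 0 ->
  reflection (u - v) *m v = u.
Proof.
rewrite -subr_eq0 => /dot_gt0/lt0r_neq0 w0 uv; rewrite reflectionE.
(* Equal norms turn the coefficient in the reflection formula into -1. *)
have -> : 2 * ((u - v)^T *m v) 0 0 = - ((u - v)^T *m (u - v)) 0 0.
  have entryB (M N : 'M[F]_1) : (M - N) 0 0 = M 0 0 - N 0 0 by rewrite !mxE.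
  rewrite [(u - v)^T]linearB /= mulmxBr !mulmxBl !entryB uv (dotC v u).
  ring.
by rewrite mulNr divff // scaleN1r opprK addrC subrK.
Qed.

(** The line spanned by [v] is the [-1]-eigenspace of its reflection, hence it
    is stable under every matrix that commutes with that reflection. *)
Lemma eigenvector_reflection B v : v != 0 ->
  reflection v *m B *m reflection v = B -> exists a : F, B *m v = a *: v.
Proof.
move=> v0 RBR.
have : reflection v *m (B *m v) = - (B *m v).
  by rewrite -[in RHS]RBR -[in RHS]mulmxA reflection_self // mulmxN opprK mulmxA.
set w := B *m v; rewrite reflectionE => /eqP.
rewrite subr_eq addrC -subr_eq opprK -mulr2n => /eqP w2.
exists ((v^T *m w) 0 0 / (v^T *m v) 0 0).
apply: (@scalerI _ _ 2); first by rewrite pnatr_eq0.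
by rewrite scaler_nat w2 scalerA mulrA.
Qed.

End Reflections.

(** * The spectral theorem for real symmetric matrices *)

Section Spectral.
Context {R : rcfType}.

Lemma orthogonalC n (Q : 'M[R]_n) : Q^T *m Q = 1%:M -> Q *m Q^T = 1%:M.
Proof. exact: mulmx1C. Qed.

(** Over the complex numbers [A] becomes Hermitian, so it has a real eigenvalue,
    and real eigenvalues do not depend on the field. *)
Lemma sym_eigenvector n (A : 'M[R]_n.+1) : A^T = A ->
  exists (a : R) (v : 'cV[R]_n.+1), v != 0 /\ A *m v = a *: v.
Proof.
move=> Asym; pose AC := map_mx (real_complex R) A.
have hermA : AC \is hermsymmx.
  apply: realsym_hermsym.
    by apply/is_hermitianmxP; rewrite expr0 scale1r map_mx_id // map_trmx Asym.
  by apply/mxOverP => i j; rewrite mxE; apply/complex_realP; exists (A i j).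
have /orthomx_spectralP AE := hermitian_normalmx hermA.
have /mxOverP /(_ 0 0) := hermitian_spectral_diag_real hermA.
move=> /complex_realP [a aE].
have : eigenvalue AC (spectral_diag AC 0 0).
  apply/eigenvalueP; exists (row 0 (spectralmx AC)).
    rewrite -row_mul {2}AE !mulmxA mulmxV ?spectral_unit // mul1mx.
    by rewrite row_mul row_diag_mx -scalemxAl -rowE.
  apply/eqP => row0; have := mulmxK (spectral_unit AC) (delta_mx 0 0 : 'rV_n.+1).
  by rewrite -rowE row0 mul0mx => /rowP/(_ 0)/eqP; rewrite !mxE eqxx eq_sym oner_eq0.
rewrite aE eigenvalue_map => /eigenvalueP [v vA v0].
exists a, v^T; rewrite trmx_eq0; split => //.
by rewrite -[A]Asym -trmx_mul vA linearZ.
Qed.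

Definition orthodiag n (Q : 'M[R]_n) (d : 'rV[R]_n) : 'M[R]_n :=
  Q^T *m diag_mx d *m Q.

(** Induction on the size: a reflection moves a unit eigenvector to the first
    basis vector, which splits off a block of size one. *)
Lemma sym_orthodiag n (A : 'M[R]_n) : A^T = A ->
  exists (Q : 'M[R]_n) d, Q^T *m Q = 1%:M /\ A = orthodiag Q d.
Proof.
elim: n A => [|n IHn] A Asym.
  by exists 1%:M, 0; split; apply/matrixP => -[].
have [a [v [v0 Av]]] := sym_eigenvector Asym.
pose e : 'cV[R]_n.+1 := delta_mx 0 0.
have [H [Hsym HH He]] : exists H : 'M[R]_n.+1,
    [/\ H^T = H, H *m H = 1%:M & A *m (H *m e) = a *: (H *m e)].
  (* The reflection exchanging [e] and the unit eigenvector [u]; it degenerates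
     when they coincide. *)
  pose u := (Num.sqrt ((v^T *m v) 0 0))^-1 *: v.
  have Au : A *m u = a *: u by rewrite -scalemxAr Av !scalerA mulrC.
  have uu : (u^T *m u) 0 0 = (e^T *m e) 0 0.
    rewrite trmx_delta mul_delta_mx [RHS]mxE eqxx /u [(_ *: v)^T]linearZ /= -scalemxAl.
    rewrite -scalemxAr scalerA [LHS]mxE -invfM -expr2 sqr_sqrtr ?ltW ?dot_gt0 //.
    by rewrite mulVf // lt0r_neq0 ?dot_gt0.
  have [ue|ue] := eqVneq u e.
    by exists 1%:M; rewrite trmx1 mulmx1 mul1mx -ue; split.
  exists (reflection (u - e)); rewrite reflection_swap //.
  by rewrite reflection_sym reflectionK ?subr_eq0.
pose M : 'M[R]_(1 + n) := H *m A *m H.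
have Msym : M^T = M by rewrite !trmx_mul Asym Hsym mulmxA.
have Me : M *m e = a *: e by rewrite -!mulmxA He -scalemxAr mulmxA HH mul1mx.
have AM : A = H *m M *m H by rewrite /M !mulmxA HH mul1mx -mulmxA HH mulmx1.
clearbody M.
have Mi0 i : M i 0 = a * (i == 0)%:R.
  move/colP: Me => /(_ i); rewrite -[M *m e]/(M *m delta_mx 0 0) -colE !mxE.
  by rewrite eqxx andbT.
have MB : M = block_mx a%:M 0 0 (drsubmx M).
  rewrite -[LHS]submxK; congr block_mx.
  - by apply/matrixP => i j; rewrite !ord1 !mxE !lshift0 Mi0 mulr1 mulr1n.
  - apply/matrixP => i j; rewrite !ord1 -Msym !mxE lshift0 Mi0.
    by rewrite mulr0.
  - by apply/matrixP => i j; rewrite !ord1 !mxE lshift0 Mi0 mulr0.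
have [|Q [d [QQ ME]]] := IHn (drsubmx M).
  by rewrite trmx_drsub Msym.
pose Q1 : 'M[R]_(1 + n) := block_mx 1%:M 0 0 Q.
have Q1E : Q1^T *m Q1 = 1%:M.
  rewrite tr_block_mx !trmx0 trmx1 mulmx_block !mulmx0 !mul0mx mulmx1 !addr0.
  by rewrite add0r QQ -scalar_mx_block.
have ME1 : M = Q1^T *m diag_mx (row_mx a%:M d) *m Q1.
  rewrite MB ME /orthodiag diag_mx_row tr_block_mx !trmx0 trmx1 !mulmx_block.
  rewrite !(mulmx0, mul0mx, mulmx1, mul1mx, addr0, add0r); congr block_mx.
  by apply/matrixP => i j; rewrite !ord1 !mxE eqxx mulr1n.
exists (Q1 *m H), (row_mx a%:M d); split.
  by rewrite trmx_mul mulmxA -(mulmxA _ Q1^T) Q1E mulmx1 Hsym.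
by rewrite AM ME1 /orthodiag trmx_mul Hsym !mulmxA.
Qed.

End Spectral.

(** * Functional calculus in an orthonormal eigenbasis *)

Section FunctionalCalculus.
Context {R : rcfType} {n : nat}.
Implicit Types (Q : 'M[R]_n) (d e : 'rV[R]_n) (v : 'cV[R]_n).

Lemma orthodiag_const Q (a : R) : Q^T *m Q = 1%:M ->
  orthodiag Q (const_mx a) = a%:M.
Proof.
by move=> QQ; rewrite /orthodiag diag_const_mx mul_mx_scalar -scalemxAl QQ scalemx1.
Qed.

Lemma orthodiagD Q d e : orthodiag Q (d + e) = orthodiag Q d + orthodiag Q e.
Proof. by rewrite /orthodiag linearD /= mulmxDr mulmxDl. Qed.

Lemma orthodiagZ Q a d : orthodiag Q (a *: d) = a *: orthodiag Q d.
Proof. by rewrite /orthodiag linearZ /= -scalemxAr -scalemxAl. Qed.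

Lemma orthodiagM Q d e : Q^T *m Q = 1%:M ->
  orthodiag Q d *m orthodiag Q e = orthodiag Q (\row_i (d 0 i * e 0 i)).
Proof.
move=> /orthogonalC QQ; rewrite /orthodiag -[RHS]mulmxA -mulmx_diag !mulmxA.
by rewrite -(mulmxA _ Q) QQ mulmx1.
Qed.

Lemma orthodiag_sym Q d : (orthodiag Q d)^T = orthodiag Q d.
Proof. by rewrite !trmx_mul trmxK tr_diag_mx mulmxA. Qed.

Lemma orthodiag_inv Q d : Q^T *m Q = 1%:M -> (forall i, d 0 i != 0) ->
  invmx (orthodiag Q d) = orthodiag Q (map_mx GRing.inv d).
Proof.
move=> QQ d0.
have dV : orthodiag Q d *m orthodiag Q (map_mx GRing.inv d) = 1%:M.
  rewrite orthodiagM // -(orthodiag_const 1 QQ); congr orthodiag.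
  by apply/rowP => i; rewrite !mxE divff.
have [du _] := mulmx1_unit dV.
by rewrite -[LHS]mulmx1 -dV mulKmx.
Qed.

(** The entries of [Q *m v] are the coordinates of [v] in the eigenbasis, in which
    the matrix is diagonal. *)
Lemma orthodiag_eigen Q d a v : Q^T *m Q = 1%:M ->
  orthodiag Q d *m v = a *: v <->
  forall i, (Q *m v) i 0 != 0 -> d 0 i = a.
Proof.
move=> QQ; split=> [dv i vi0|da].
  have : diag_mx d *m (Q *m v) = a *: (Q *m v).
    rewrite [RHS]scalemxAr -dv /orthodiag !mulmxA (orthogonalC QQ).
    by rewrite mul1mx.
  by rewrite mul_diag_mx => /colP/(_ i); rewrite [LHS]mxE [RHS]mxE => /(mulIf vi0).
have -> : a *: v = Q^T *m (a *: (Q *m v)) by rewrite -scalemxAr mulmxA QQ mul1mx.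
rewrite /orthodiag -!mulmxA mul_diag_mx; congr (_ *m _); apply/colP => i.
rewrite [LHS]mxE [RHS]mxE; have [->|/da ->//] := eqVneq ((Q *m v) i 0) 0.
by rewrite !mulr0.
Qed.

Lemma orthodiag_basis Q d i (v : 'cV[R]_n := Q^T *m delta_mx i 0) : Q^T *m Q = 1%:M ->
  v != 0 /\ orthodiag Q d *m v = d 0 i *: v.
Proof.
move=> QQ; have Qv : Q *m v = delta_mx i 0 by rewrite mulmxA orthogonalC // mul1mx.
split.
  apply/eqP => v0; move/colP: Qv => /(_ i); rewrite v0 mulmx0 !mxE !eqxx.
  by move/eqP; rewrite eq_sym oner_eq0.
apply/(orthodiag_eigen _ _ _ QQ) => j; rewrite Qv !mxE eqxx andbT.
by case: (eqVneq j i) => [->|_]; rewrite ?eqxx.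
Qed.

Lemma orthodiag_tr Q (d : 'rV[R]_n) : Q^T *m Q = 1%:M ->
  \tr (orthodiag Q d) = \sum_i d 0 i.
Proof.
by move=> QQ; rewrite /orthodiag mxtrace_mulC mulmxA (orthogonalC QQ) mul1mx mxtrace_diag.
Qed.

Lemma orthodiag_det Q (d : 'rV[R]_n) : Q^T *m Q = 1%:M ->
  \det (orthodiag Q d) = \prod_i d 0 i.
Proof.
move=> QQ; rewrite /orthodiag !det_mulmx mulrAC -det_mulmx QQ det1 mul1r.
exact: det_diag.
Qed.

Lemma orthodiag_char_poly Q (d : 'rV[R]_n) : Q^T *m Q = 1%:M ->
  char_poly (orthodiag Q d) = \prod_i ('X - (d 0 i)%:P).
Proof.
move=> QQ; pose QX := map_mx polyC Q.
have QQX : QX^T *m QX = 1%:M by rewrite map_trmx -map_mxM QQ map_mx1.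
have -> : \prod_i ('X - (d 0 i)%:P) = \det (char_poly_mx (diag_mx d)).
  rewrite -/(char_poly _) char_poly_trig ?diag_mx_is_trig //.
  by apply: eq_bigr => i _; rewrite mxE eqxx mulr1n.
rewrite /char_poly.
have -> : char_poly_mx (orthodiag Q d) = QX^T *m char_poly_mx (diag_mx d) *m QX.
  rewrite /char_poly_mx mulmxBr mulmxBl mul_mx_scalar -scalemxAl QQX scalemx1.
  by rewrite /orthodiag !map_mxM map_trmx.
by rewrite !det_mulmx mulrAC -det_mulmx QQX det1 mul1r.
Qed.

(** Listing the entries of [d] in another order amounts to permuting the
    eigenbasis, which keeps it orthonormal. *)
Lemma orthodiag_perm Q Q' d d' : Q^T *m Q = 1%:M -> Q'^T *m Q' = 1%:M ->
  perm_eq [seq d' 0 i | i : 'I_n] [seq d 0 i | i : 'I_n] ->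
  exists P, P^T *m P = 1%:M /\ orthodiag Q' d' = P^T *m orthodiag Q d *m P.
Proof.
move=> QQ QQ' pdd.
have /tuple_permP [p pE] : perm_eq [seq d' 0 i | i : 'I_n] [tuple d 0 i | i < n].
  exact: pdd.
have dp i : d' 0 i = d 0 (p i).
  have := congr1 (fun s => nth 0 s i) pE.
  by rewrite (nth_map i) ?size_enum_ord // nth_ord_enum nth_mktuple tnth_mktuple.
pose S := perm_mx p : 'M[R]_n.
have SS : S *m S^T = 1%:M by rewrite tr_perm_mx -perm_mxM mulgV perm_mx1.
exists (Q^T *m S^T *m Q'); rewrite !trmx_mul !trmxK; split.
  rewrite !mulmxA -(mulmxA _ Q) (orthogonalC QQ) mulmx1.
  by rewrite -(mulmxA _ S) SS mulmx1.
have -> : orthodiag Q' d' = Q'^T *m (S *m diag_mx d *m S^T) *m Q'.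
  congr (_ *m _ *m _); rewrite tr_perm_mx -row_permE -col_permE.
  apply/matrixP => i j; rewrite !mxE dp; congr (_ *+ nat_of_bool _).
  by rewrite (inj_eq perm_inj).
rewrite /orthodiag !mulmxA -(mulmxA _ Q) (orthogonalC QQ) mulmx1.
by rewrite -(mulmxA _ Q) (orthogonalC QQ) mulmx1.
Qed.

End FunctionalCalculus.

(** * Interpolation *)

Lemma interpolation (F : fieldType) (I : eqType) (s : seq I) (x y : I -> F) :
  {in s &, forall i j, x i = x j -> y i = y j} ->
  exists2 p : {poly F}, (size p <= size s)%N & {in s, forall i, p.[x i] = y i}.
Proof.
elim: s => [|i s IHs] xy; first by exists 0; rewrite ?size_poly0.
have [|p ps px] := IHs.
  by move=> j k js ks; apply: xy; rewrite in_cons ?js ?ks orbT.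
(* [w] vanishes at the nodes already treated, so adding a multiple of it only
   changes the value at [x i]. *)
pose w := \prod_(z <- map x s) ('X - z%:P).
have w0 j : j \in s -> w.[x j] = 0.
  by move=> js; apply/rootP; rewrite root_prod_XsubC map_f.
have [/mapP[j js xij]|xi] := boolP (x i \in map x s).
  exists p; first exact: leqW.
  move=> k; rewrite in_cons => /predU1P[->|]; last exact: px.
  rewrite xij px //; apply: xy => //; first by rewrite in_cons js orbT.
  exact: mem_head.
exists (p + ((y i - p.[x i]) / w.[x i]) *: w).
  rewrite (leq_trans (size_polyD _ _)) // geq_max (leqW ps) /=.
  by rewrite (leq_trans (size_scale_leq _ _)) // size_prod_XsubC size_map.
move=> k; rewrite in_cons !hornerE => /predU1P[->|ks].
  by rewrite divfK ?subrKC //; move: xi; rewrite -root_prod_XsubC.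
by rewrite (w0 k ks) mulr0 addr0 px.
Qed.

(** * Positive definite matrices and their invariants *)

Section PositiveDefinite.
Context {R : realType}.
Implicit Types (A B Q : 'M[R]_3) (d : 'rV[R]_3) (v : 'cV[R]_3).

Lemma Sym3P A : Sym3 A <-> A^T = A.
Proof.
have symE : map_mx idfun A^T = A^T by apply: map_mx_id.
split=> [/is_hermitianmxP|AT]; first by rewrite expr0 scale1r symE => <-.
by apply/is_hermitianmxP; rewrite expr0 scale1r symE AT.
Qed.

Lemma SymPos3_orthodiag Q d : Q^T *m Q = 1%:M ->
  SymPos3 (orthodiag Q d) <-> forall i, 0 < d 0 i.
Proof.
move=> QQ; split=> [[_ pos] i|d0].
  have [v0 dv] := orthodiag_basis d i QQ.
  have := pos _ v0; rewrite -mulmxA dv -scalemxAr mxE pmulr_lgt0 //.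
  exact: dot_gt0.
split; first by apply/Sym3P; exact: orthodiag_sym.
move=> v v0; pose w := diag_mx (map_mx Num.sqrt d) *m (Q *m v).
have -> : v^T *m orthodiag Q d *m v = w^T *m w.
  rewrite !trmx_mul tr_diag_mx /orthodiag !mulmxA; congr (_ *m _ *m _).
  rewrite -[RHS]mulmxA mulmx_diag; congr (_ *m diag_mx _).
  by apply/rowP => i; rewrite !mxE -expr2 sqr_sqrtr ?ltW.
apply: dot_gt0; apply: contra v0 => /eqP w0.
rewrite -[v]mul1mx -QQ -mulmxA; suff -> : Q *m v = 0 by rewrite mulmx0.
apply/colP => i; move/colP: w0 => /(_ i).
rewrite /w mul_diag_mx [LHS]mxE [_ 0 i]mxE [RHS]mxE => /eqP.
by rewrite mulf_eq0 gt_eqF ?sqrtr_gt0 //= [RHS]mxE => /eqP.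
Qed.

Lemma SymPos3_spectral B : SymPos3 B ->
  exists Q d, [/\ Q^T *m Q = 1%:M, forall i, 0 < d 0 i & B = orthodiag Q d].
Proof.
move=> Bpos; have [/Sym3P/sym_orthodiag[Q [d [QQ BE]]] _] := Bpos.
by exists Q, d; split=> //; apply/(SymPos3_orthodiag _ QQ); rewrite -BE.
Qed.

Lemma SymPos3_conj B Q : SymPos3 B -> Q^T *m Q = 1%:M ->
  SymPos3 (Q^T *m B *m Q).
Proof.
move=> /SymPos3_spectral[P [d [PP d0 ->]]] QQ.
have -> : Q^T *m orthodiag P d *m Q = orthodiag (P *m Q) d.
  by rewrite /orthodiag trmx_mul !mulmxA.
apply/SymPos3_orthodiag => //.
by rewrite trmx_mul mulmxA -(mulmxA _ P^T) PP mulmx1.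
Qed.

Lemma orthodiag_invariants Q d : Q^T *m Q = 1%:M ->
  let B := orthodiag Q d in
  \prod_i ('X - (d 0 i)%:P) =
  'X^3 - (inv1 B)%:P * 'X^2 + (inv2 B)%:P * 'X - (inv3 B)%:P.
Proof.
move=> QQ /=; rewrite /inv1 /inv2 /inv3 orthodiagM // !orthodiag_tr //.
rewrite orthodiag_det // !big_ord_recl !big_ord0 !mxE.
move: (d _ _) (d _ _) (d _ _) => c b a.
have -> : 2^-1 * ((a + (b + (c + 0))) ^+ 2 - (a * a + (b * b + (c * c + 0))))
    = a * b + b * c + c * a by field.
rewrite !(polyCD, polyCM); ring.
Qed.

(** The invariants are the coefficients of the characteristic polynomial, so
    they determine the spectrum with multiplicities. *)
Lemma same_invariants_conj B B' : SymPos3 B -> SymPos3 B' ->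
  inv1 B' = inv1 B -> inv2 B' = inv2 B -> inv3 B' = inv3 B ->
  exists Q, Q^T *m Q = 1%:M /\ B' = Q^T *m B *m Q.
Proof.
move=> /SymPos3_spectral[Q [d [QQ d0 ->]]] /SymPos3_spectral[P [e [PP e0 ->]]].
move=> eq1 eq2 eq3; apply: orthodiag_perm => //; apply: prod_XsubC_eq.
rewrite !big_image /=.
by rewrite (orthodiag_invariants e PP) eq1 eq2 eq3 -orthodiag_invariants.
Qed.

Lemma eigenvalue_list_eigenvector B mu i : Sym3 B -> eigenvalue_list B mu ->
  exists v, eigenvector_for B (mu i) v.
Proof.
move=> /Sym3P BT Bmu; have : eigenvalue B (mu i).
  by rewrite eigenvalue_root_char Bmu rootE horner_prod (bigD1 i) //= !hornerE
    subrr mul0r.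
case/eigenvalueP => v vB v0; exists v^T; split; first by rewrite trmx_eq0.
by rewrite -[B]BT -trmx_mul vB linearZ.
Qed.

Lemma eigenvector_for_unique B a b v :
  eigenvector_for B a v -> eigenvector_for B b v -> a = b.
Proof.
move=> [v0 Bv] [_]; rewrite Bv => /eqP; rewrite -subr_eq0 -scalerBl scaler_eq0 (negPf v0) orbF.
by rewrite subr_eq0 => /eqP.
Qed.

End PositiveDefinite.

(** * Isotropic functions *)

Section Isotropic.
Context {R : realType}.
Variables (sigma : 'M[R]_3 -> 'M[R]_3) (betam1 beta0 beta1 : 'M[R]_3 -> R).
Hypothesis sigma_iso : isotropic_function sigma.
Hypothesis sigma_rep : representation sigma betam1 beta0 beta1.

(** By the representation, the factor by which [sigma B] acts on the
    eigenvectors of [B] for the eigenvalue [x]. *)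
Definition principal_response (B : 'M[R]_3) (x : R) : R :=
  beta0 B + beta1 B * x + betam1 B * x^-1.

Lemma sigma_orthodiag (Q : 'M[R]_3) (d : 'rV[R]_3) : Q^T *m Q = 1%:M ->
  (forall i, 0 < d 0 i) ->
  sigma (orthodiag Q d) =
  orthodiag Q (map_mx (principal_response (orthodiag Q d)) d).
Proof.
move=> QQ d0; rewrite sigma_rep; last exact/SymPos3_orthodiag.
rewrite orthodiag_inv // => [|i]; last exact: lt0r_neq0.
rewrite -(orthodiag_const _ QQ) -!orthodiagZ -!orthodiagD; congr orthodiag.
by apply/rowP => i; rewrite !mxE.
Qed.

Lemma sigma_eigenvector_for B a v : SymPos3 B -> eigenvector_for B a v ->
  eigenvector_for (sigma B) (principal_response B a) v.
Proof.
move=> /SymPos3_spectral[Q [d [QQ d0 ->]]] [v0 /(orthodiag_eigen _ _ _ QQ) da].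
split=> //; rewrite sigma_orthodiag //; apply/(orthodiag_eigen _ _ _ QQ) => i.
by move=> /da <-; rewrite mxE.
Qed.

Lemma sigma_eigenvector B v : SymPos3 B -> eigenvector B v ->
  eigenvector (sigma B) v.
Proof. by move=> Bpos [a /(sigma_eigenvector_for Bpos) Sv]; eexists; exact: Sv. Qed.

(** Bi-coaxiality read in an eigenbasis: [sigma] does not merge eigenspaces of
    [B] that belong to distinct eigenvalues. *)
Definition spectrally_injective :=
  forall (Q : 'M[R]_3) (d : 'rV[R]_3), Q^T *m Q = 1%:M -> (forall i, 0 < d 0 i) ->
  forall i j, principal_response (orthodiag Q d) (d 0 i) =
              principal_response (orthodiag Q d) (d 0 j) -> d 0 i = d 0 j.

Lemma E_TSS_WE_TSS : E_TSS betam1 beta0 beta1 -> WE_TSS betam1 beta1.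
Proof. by move=> E B /E[b1 _ b2] _; split=> //; [exact: ltW|right]. Qed.

(** Unless [B] is a multiple of the identity, its principal response is strictly
    increasing on the positive reals; for a multiple of the identity there are no
    two distinct eigenvalues to compare. *)
Lemma WE_TSS_BE_plus : WE_TSS betam1 beta1 -> BE_plus sigma.
Proof.
move=> WE B Bpos lambda s lambda0 Blist Bs i j lij.
have ev k : exists v, eigenvector_for B (lambda k ^+ 2) v.
  by have [v] := eigenvalue_list_eigenvector k Bpos.1 Blist; exists v.
have sE k : s k = principal_response B (lambda k ^+ 2).
  have [v Bv] := ev k; apply: (eigenvector_for_unique (Bs _ _ Bv)).
  exact: sigma_eigenvector_for.
have ltx : lambda j ^+ 2 < lambda i ^+ 2.
  by rewrite ltr_pXn2r // ?nnegrE ltW.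
have ltV : (lambda i ^+ 2)^-1 < (lambda j ^+ 2)^-1.
  by rewrite ltf_pV2 // posrE exprn_gt0.
have Bnot : ~ exists c : R, 0 < c /\ B = c%:M.
  move=> [c [_ Bc]]; suff lc k : lambda k ^+ 2 = c by rewrite !lc ltxx in ltx.
  have [v Bv] := ev k; apply: (eigenvector_for_unique Bv).
  by split; [case: Bv|rewrite Bc mul_scalar_mx].
rewrite !sE /principal_response.
case: (WE B Bpos Bnot) => bm b1 bs.
rewrite -subr_gt0 in ltx; rewrite -subr_lt0 in ltV; rewrite -subr_gt0.
set x := lambda i ^+ 2 in ltx ltV *; set y := lambda j ^+ 2 in ltx ltV *.
have -> : beta0 B + beta1 B * x + betam1 B * x^-1
    - (beta0 B + beta1 B * y + betam1 B * y^-1)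
    = beta1 B * (x - y) + betam1 B * (x^-1 - y^-1) by ring.
case: bs => [bm0|b10].
  by rewrite ltr_wpDl ?mulr_ge0 ?(ltW ltx) // nmulr_rgt0.
by rewrite ltr_pwDl ?mulr_gt0 // mulr_le0 // ltW.
Qed.

Lemma BE_plus_injective : BE_plus sigma -> spectrally_injective.
Proof.
move=> BE Q d QQ d0 i j fij; set B := orthodiag Q d in fij.
have sq k : Num.sqrt (d 0 k) ^+ 2 = d 0 k by rewrite sqr_sqrtr ?ltW.
have Bpos : SymPos3 B by apply/SymPos3_orthodiag.
have lt k l : d 0 l < d 0 k ->
    principal_response B (d 0 l) < principal_response B (d 0 k).
  move=> dlk; apply: (BE B Bpos (fun m => Num.sqrt (d 0 m))
                         (fun m => principal_response B (d 0 m))) => //.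
  - by move=> m; rewrite sqrtr_gt0.
  - rewrite /eigenvalue_list orthodiag_char_poly //.
    by apply: eq_bigr => m _; rewrite sq.
  - by move=> m v; rewrite sq => Bv; exact: sigma_eigenvector_for.
  - by rewrite ltr_sqrt.
by case: (ltgtP (d 0 i) (d 0 j)) => // /lt; rewrite fij ltxx.
Qed.

Lemma injective_bi_coaxial : spectrally_injective -> bi_coaxial sigma.
Proof.
move=> inj B Bpos v; split; first exact: sigma_eigenvector.
move: (Bpos) => /SymPos3_spectral[Q [d [QQ d0 BE]]] [a [v0]].
rewrite BE sigma_orthodiag // => /(orthodiag_eigen _ _ _ QQ) da.
have [i vi0] : exists i, (Q *m v) i 0 != 0.
  apply/existsP; rewrite -negb_forall; apply: contra v0 => /forallP Qv0.
  rewrite -[v]mul1mx -QQ -mulmxA; suff -> : Q *m v = 0 by rewrite mulmx0.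
  by apply/colP => i; rewrite [RHS]mxE; apply/eqP.
exists (d 0 i); split=> //; apply/(orthodiag_eigen _ _ _ QQ) => j vj0.
by apply: inj QQ d0 _ _ _; move: (da i vi0) (da j vj0); rewrite !mxE => -> ->.
Qed.

(** If two eigenvalues of [B] had the same image, then the sum of the two basis
    eigenvectors would be an eigenvector of [sigma B], hence of [B]. *)
Lemma bi_coaxial_injective : bi_coaxial sigma -> spectrally_injective.
Proof.
move=> coax Q d QQ d0 i j fij; set B := orthodiag Q d in fij.
have Bpos : SymPos3 B by apply/SymPos3_orthodiag.
pose v : 'cV_3 := Q^T *m (delta_mx i 0 + delta_mx j 0).
have Qv k : (Q *m v) k 0 = (k == i)%:R + (k == j)%:R.
  by rewrite mulmxA orthogonalC // mul1mx !mxE eqxx !andbT.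
have vi : (Q *m v) i 0 != 0 by rewrite Qv eqxx lt0r_neq0 // ltr_pwDl.
have vj : (Q *m v) j 0 != 0 by rewrite Qv eqxx lt0r_neq0 // ltr_wpDl.
have : eigenvector (sigma B) v.
  exists (principal_response B (d 0 i)); split.
    by apply: contra vi => /eqP ->; rewrite mulmx0 mxE.
  rewrite sigma_orthodiag //; apply/(orthodiag_eigen _ _ _ QQ) => k.
  rewrite Qv mxE; case: (eqVneq k i) => [->//|_]; case: (eqVneq k j) => [->//|_].
  by rewrite addr0 eqxx.
by case/(coax B Bpos) => a [_ /(orthodiag_eigen _ _ _ QQ) da]; rewrite !da.
Qed.

(** Interpolation expresses the eigenvalues of [B] through those of [sigma B]
    by a polynomial of degree at most two. *)
Lemma injective_quadratic B : spectrally_injective -> SymPos3 B ->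
  exists p : R * R * R,
    B = p.1.1%:M + p.1.2 *: sigma B + p.2 *: (sigma B *m sigma B).
Proof.
move=> inj /SymPos3_spectral[Q [d [QQ d0 BE]]].
have sE := sigma_orthodiag QQ d0.
have [|p p3 pE] := @interpolation R 'I_3 (enum 'I_3)
  (fun i => principal_response B (d 0 i)) (fun i => d 0 i).
  by move=> i j _ _; rewrite BE; exact: inj.
exists (p`_0, p`_1, p`_2); rewrite /= BE sE orthodiagM //.
rewrite -(orthodiag_const _ QQ) -!orthodiagZ -!orthodiagD; congr orthodiag.
apply/rowP => i; rewrite !mxE -BE -[LHS](pE i) ?mem_enum //.
rewrite (horner_coef_wide _ (n := 3)); last by rewrite size_enum_ord in p3.
by rewrite !big_ord_recl big_ord0 /= expr0 mulr1 expr1 addr0 addrA expr2.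
Qed.

(** By isotropy the coefficients found for one matrix serve for all its
    orthogonal conjugates, that is, for all matrices with the same
    invariants. *)
Lemma injective_semi_invertible : spectrally_injective -> semi_invertible sigma.
Proof.
move=> inj; pose good (x p : R * R * R) := forall B, SymPos3 B ->
  (inv1 B, inv2 B, inv3 B) = x ->
  B = p.1.1%:M + p.1.2 *: sigma B + p.2 *: (sigma B *m sigma B).
have /choice[psi psiE] : forall x, exists p, good x p.
  move=> x.
  have [[B [Bpos Bx]]|noB] :=
    pselect (exists B, SymPos3 B /\ (inv1 B, inv2 B, inv3 B) = x); last first.
    by exists (0, 0, 0) => B Bpos Bx; case: noB; exists B.
  have [p BE] := injective_quadratic inj Bpos; exists p => C Cpos.
  rewrite -Bx => -[eq1 eq2 eq3].
  have [Q [QQ CE]] := same_invariants_conj Bpos Cpos eq1 eq2 eq3.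
  have sC : sigma C = Q^T *m sigma B *m Q by rewrite CE; exact: sigma_iso.2.
  have ssC : sigma C *m sigma C = Q^T *m (sigma B *m sigma B) *m Q.
    by rewrite sC !mulmxA -(mulmxA _ Q) (orthogonalC QQ) mulmx1.
  rewrite ssC sC {1}CE {1}BE !mulmxDr !mulmxDl mul_mx_scalar.
  by rewrite -!scalemxAr -!scalemxAl QQ scalemx1.
exists (fun a b c => (psi (a, b, c)).1.1), (fun a b c => (psi (a, b, c)).1.2),
  (fun a b c => (psi (a, b, c)).2) => B Bpos.
exact: psiE.
Qed.

Lemma semi_invertible_bi_coaxial : semi_invertible sigma -> bi_coaxial sigma.
Proof.
move=> [psi0 [psi1 [psi2 psiE]]] B Bpos v; split; first exact: sigma_eigenvector.
case=> a [v0 Sv]; eexists; split=> //.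
rewrite [in LHS](psiE B Bpos) !mulmxDl mul_scalar_mx -!scalemxAl -mulmxA !Sv.
by rewrite -scalemxAr Sv !scalerA -!scalerDl.
Qed.

(** The reflection in an eigenvector of [sigma B] fixes [sigma B] under
    conjugation; by isotropy and injectivity it fixes [B] as well. *)
Lemma invertible_bi_coaxial : invertible sigma -> bi_coaxial sigma.
Proof.
move=> [tau [_ tauK _]] B Bpos v; split; first exact: sigma_eigenvector.
case=> a [v0 Sv]; have /Sym3P ST := sigma_iso.1 B Bpos.
have RR := reflectionK v0; have RT := reflection_sym v.
have SR : reflection v *m sigma B = sigma B *m reflection v.
  have vS : v^T *m sigma B = a *: v^T by rewrite -[in LHS]ST -trmx_mul Sv linearZ.
  rewrite mulmxBl mulmxBr mul1mx mulmx1 -scalemxAl -scalemxAr mulmxA Sv.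
  by rewrite -mulmxA vS -scalemxAl -scalemxAr.
have RTR : (reflection v)^T *m reflection v = 1%:M by rewrite RT.
suff /eigenvector_reflection[//|b Bv] : reflection v *m B *m reflection v = B.
  by exists b.
have Cpos := SymPos3_conj Bpos RTR.
rewrite -{1}RT (tauK _ Cpos) [RHS](tauK _ Bpos); congr tau.
by rewrite sigma_iso.2 // RT SR -mulmxA RR mulmx1.
Qed.

End Isotropic.

(** * An invertible function that reverses the order of the eigenvalues *)

Section Counterexample.
Context {R : realType}.
Implicit Types (B Q Y : 'M[R]_3) (d : 'rV[R]_3).

Definition inv_minus B : 'M[R]_3 := invmx B - B.

Lemma inv_minus_rep :
  representation inv_minus (fun=> 1) (fun=> 0) (fun=> -1).
Proof.
by move=> B _; rewrite scale1r scaleN1r -scalemx1 scale0r add0r addrC.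
Qed.

Lemma inv_minus_orthodiag Q d : Q^T *m Q = 1%:M -> (forall i, 0 < d 0 i) ->
  inv_minus (orthodiag Q d) = orthodiag Q (map_mx (fun x => x^-1 - x) d).
Proof.
move=> QQ d0; rewrite (sigma_orthodiag inv_minus_rep QQ d0); congr orthodiag.
by apply/rowP => i; rewrite !mxE /principal_response; ring.
Qed.

Lemma inv_minus_isotropic : isotropic_function inv_minus.
Proof.
split=> [B /SymPos3_spectral[Q [d [QQ d0 ->]]]|B Q].
  by apply/Sym3P; rewrite inv_minus_orthodiag // orthodiag_sym.
move=> /SymPos3_spectral[P [d [PP d0 ->]]] QQ.
have conjE e : Q^T *m orthodiag P e *m Q = orthodiag (P *m Q) e.
  by rewrite /orthodiag trmx_mul !mulmxA.
rewrite inv_minus_orthodiag // !conjE inv_minus_orthodiag //.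
by rewrite trmx_mul mulmxA -(mulmxA _ P^T) PP mulmx1.
Qed.

Lemma invB_inj (x y : R) : 0 < x -> 0 < y -> x^-1 - x = y^-1 - y -> x = y.
Proof.
have lt (a b : R) : 0 < a -> a < b -> b^-1 - b < a^-1 - a.
  move=> a0 ab; rewrite ltrD // ?ltrN2 // ltf_pV2 ?posrE //.
  exact: lt_trans ab.
move=> x0 y0 xy; case: (ltgtP x y) => // /lt; rewrite xy ltxx.
  by move=> /(_ x0).
by move=> /(_ y0).
Qed.

(** The positive solution of [x^-1 - x = t]. *)
Definition invB_inv (t : R) : R := (Num.sqrt (t ^+ 2 + 4) - t) / 2.

Lemma invB_inv_gt0 t : 0 < invB_inv t.
Proof.
rewrite divr_gt0 // subr_gt0 (le_lt_trans (ler_norm t)) // -sqrtr_sqr.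
by rewrite ltr_sqrt ?ltrDl // ltr_wpDl ?sqr_ge0.
Qed.

Lemma invB_invK t : (invB_inv t)^-1 - invB_inv t = t.
Proof.
have := invB_inv_gt0 t; rewrite /invB_inv.
have : Num.sqrt (t ^+ 2 + 4) ^+ 2 = t ^+ 2 + 4.
  by rewrite sqr_sqrtr // addr_ge0 ?sqr_ge0.
move: (Num.sqrt _) => r rr r0.
have rt : r - t != 0 by apply: contraTneq r0 => ->; rewrite mul0r ltxx.
apply: (mulIf rt); rewrite mulrBl invf_div divfK //.
have -> : (r - t) / 2 * (r - t) = (r ^+ 2 - 2 * r * t + t ^+ 2) / 2 by field.
by rewrite rr; field.
Qed.

(** The eigenvectors of [C] are eigenvectors of the common image; since
    [x |-> x^-1 - x] is injective on the positive reals, they are eigenvectors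
    of [B] for the same eigenvalues, and they span the space. *)
Lemma inv_minus_inj B C : SymPos3 B -> SymPos3 C ->
  inv_minus B = inv_minus C -> B = C.
Proof.
move=> /SymPos3_spectral[Q [d [QQ d0 ->]]] /SymPos3_spectral[P [e [PP e0 ->]]].
rewrite !inv_minus_orthodiag // => eqBC.
have eqP : orthodiag Q d *m P^T = orthodiag P e *m P^T.
  apply: trmx_inj; apply/row_matrixP => j; rewrite -!tr_col !colE.
  congr trmx; rewrite -(mulmxA (orthodiag Q d)) -(mulmxA (orthodiag P e)).
  have [v0 ->] := orthodiag_basis e j PP.
  have [_ Sv] := orthodiag_basis (map_mx (fun x => x^-1 - x) e) j PP.
  move: Sv; rewrite -eqBC => /(orthodiag_eigen _ _ _ QQ) de.
  apply/(orthodiag_eigen _ _ _ QQ) => i /de; rewrite !mxE.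
  exact: invB_inj.
by rewrite -[LHS]mulmx1 -PP mulmxA eqP -mulmxA PP mulmx1.
Qed.

Lemma inv_minus_invertible : invertible inv_minus.
Proof.
have /choice[tau tauE] : forall Y, exists B,
    Sym3 Y -> SymPos3 B /\ Y = inv_minus B.
  move=> Y; have [/Sym3P/sym_orthodiag[Q [t [QQ YE]]]|nY] := pselect (Sym3 Y);
    last by exists 0.
  have g0 i : 0 < map_mx invB_inv t 0 i by rewrite mxE invB_inv_gt0.
  exists (orthodiag Q (map_mx invB_inv t)) => _; split.
    exact/SymPos3_orthodiag.
  rewrite inv_minus_orthodiag // YE; congr orthodiag.
  by apply/rowP => i; rewrite !mxE invB_invK.
exists tau; split=> [Y /tauE[]//|B Bpos|Y /tauE[]//].
have [tpos tE] := tauE _ (inv_minus_isotropic.1 B Bpos).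
exact: inv_minus_inj.
Qed.

(** On the diagonal matrix with entries 1, 4, 9, the values of [x^-1 - x]
    decrease. *)
Lemma inv_minus_not_BE_plus : ~ BE_plus inv_minus.
Proof.
move=> BE; pose lambda (i : 'I_3) : R := i.+1%:R.
pose B := orthodiag 1%:M (\row_i (lambda i ^+ 2)).
have II : (1%:M : 'M[R]_3)^T *m 1%:M = 1%:M by rewrite trmx1 mulmx1.
have Bpos : SymPos3 B.
  by apply/SymPos3_orthodiag => // i; rewrite mxE exprn_gt0 ?ltr0n.
pose s i := principal_response (fun=> 1) (fun=> 0) (fun=> -1) B (lambda i ^+ 2).
have := BE B Bpos lambda s _ _ _ (inord 1) (inord 0).
rewrite /s /principal_response /lambda !inordK //= => H.
have : 0 + -1 * 1 ^+ 2 + 1 * (1 ^+ 2)^-1 < 0 + -1 * 2 ^+ 2 + 1 * (2 ^+ 2)^-1 :> R.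
  apply: H.
  - by move=> i; rewrite ltr0n.
  - rewrite /eigenvalue_list orthodiag_char_poly //.
    by apply: eq_bigr => i _; rewrite mxE.
  - by move=> i v Bv; exact: (sigma_eigenvector_for inv_minus_rep Bpos Bv).
  - by rewrite ltr_nat.
have : (2 ^+ 2 : R)^-1 <= 1 by rewrite invf_le1 ?exprn_gt0 ?exprn_ege1 ?ler1n.
rewrite expr1n invr1; lra.
Qed.

End Counterexample.

Theorem theorem3p9 (R : realType) :
  (forall (sigma : 'M[R]_3 -> 'M[R]_3) (betam1 beta0 beta1 : 'M[R]_3 -> R),
      isotropic_function sigma ->
      representation sigma betam1 beta0 beta1 ->
      (E_TSS betam1 beta0 beta1 -> WE_TSS betam1 beta1) /\
      (WE_TSS betam1 beta1 -> BE_plus sigma) /\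
      (BE_plus sigma -> bi_coaxial sigma) /\
      (bi_coaxial sigma <-> semi_invertible sigma) /\
      (invertible sigma -> semi_invertible sigma)) /\
  (exists (sigma : 'M[R]_3 -> 'M[R]_3) (betam1 beta0 beta1 : 'M[R]_3 -> R),
      isotropic_function sigma /\
      representation sigma betam1 beta0 beta1 /\
      invertible sigma /\
      ~ BE_plus sigma).
Proof.
split=> [sigma betam1 beta0 beta1 iso rep|].
  have coax_semi : bi_coaxial sigma -> semi_invertible sigma.
    move=> /(bi_coaxial_injective rep); exact: (injective_semi_invertible iso rep).
  split; first exact: E_TSS_WE_TSS.
  split; first exact: (WE_TSS_BE_plus rep).
  split=> [/(BE_plus_injective rep)|]; first exact: (injective_bi_coaxial rep).
  split; last by move=> /(invertible_bi_coaxial iso rep)/coax_semi.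
  by split=> //; exact: (semi_invertible_bi_coaxial rep).
exists inv_minus, (fun=> 1), (fun=> 0), (fun=> -1).
split; first exact: inv_minus_isotropic.
split; first exact: inv_minus_rep.
split; first exact: inv_minus_invertible.
exact: inv_minus_not_BE_plus.
Qed.
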